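(* Let $L$ be a nilpotent, finite-dimensional diassociative algebra of class $n$ over a field $\mathbb{F}$. Then $$\dim\mathcal{H}^2(L,\mathbb{F})\le\dim\mathcal{H}^2(L/L^n,\mathbb{F})+4\dim(L^n)\dim(L/Z_{n-1})-\dim(L^n).$$
   Context: A diassociative algebra $L$ over a field $\mathbb{F}$ is an $\mathbb{F}$-vector space with two associative bilinear products $\dashv,\vdash$ satisfying $x\dashv(y\dashv z)=x\dashv(y\vdash z)$, $(x\vdash y)\dashv z=x\vdash(y\dashv z)$, $(x\dashv y)\vdash z=(x\vdash y)\vdash z$ for all $x,y,z\in L$. The center $Z(L)$ is the set of $z\in L$ with $z\dashv x=z\vdash x=x\dashv z=x\vdash z=0$ for all $x\in L$. For subalgebras $X,Y$ of $L$, $X\lozenge Y=X\dashv Y+X\vdash Y$, where $X\dashv Y$ and $X\vdash Y$ are the spans of the corresponding products. The lower central series is $L^1=L$, $L^{k+1}=L^1\lozenge L^k+L^2\lozenge L^{k-1}+\cdots+L^k\lozenge L^1$. $L$ is nilpotent of class $n$ ($n\ge1$) if $L^n\neq0$ and $L^{n+1}=0$. The upper central series is $Z_0=0$, $Z_1=Z(L)$, $Z_{j+1}=\{x\in L\mid\forall l\in L,\ x\dashv l,\ x\vdash l,\ l\dashv x,\ l\vdash x\in Z_j\}$ for $j\ge1$. For a diassociative algebra $Q$ over $\mathbb{F}$, $\mathcal{Z}^2(Q,\mathbb{F})$ is the space of pairs $(f_{\dashv},f_{\vdash})$ of bilinear forms $Q\times Q\to\mathbb{F}$ such that for all $i,j,k\in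 Q$: $f_{\dashv}(i,j\dashv k)=f_{\dashv}(i,j\vdash k)$; $f_{\dashv}(i\vdash j,k)=f_{\vdash}(i,j\dashv k)$; $f_{\vdash}(i\dashv j,k)=f_{\vdash}(i\vdash j,k)$; $f_{\dashv}(i,j\dashv k)=f_{\dashv}(i\dashv j,k)$; $f_{\vdash}(i,j\vdash k)=f_{\vdash}(i\vdash j,k)$. $\mathcal{B}^2(Q,\mathbb{F})$ is the subspace of pairs for which there is a linear map $\varepsilon:Q\to\mathbb{F}$ with $f_{\dashv}(x,y)=-\varepsilon(x\dashv y)$ and $f_{\vdash}(x,y)=-\varepsilon(x\vdash y)$ for all $x,y$; and $\mathcal{H}^2(Q,\mathbb{F})=\mathcal{Z}^2(Q,\mathbb{F})/\mathcal{B}^2(Q,\mathbb{F})$. *)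

(* Defs.v *)
From HB Require Import structures.
From mathcomp Require Import all_boot all_order all_algebra.
From mathcomp Require Import boolp.

Set Implicit Arguments.
Unset Strict Implicit.
Unset Printing Implicit Defensive.

Import GRing.Theory.

Local Open Scope ring_scope.
Local Open Scope quotient_scope.

Reserved Notation "x ⊣ y" (at level 40, left associativity).
Reserved Notation "x ⊢ y" (at level 40, left associativity).

Section Span.
Variables (F : fieldType) (V : vectType F).
Implicit Types (P : V -> Prop) (U : {vspace V}).

Lemma vspan_subproof P : exists U, (forall v, P v -> v \in U) /\
  forall W : {vspace V}, (forall v, P v -> v \in W) -> (U <= W)%VS.
Proof.
pose Q n := `[< exists2 U : {vspace V}, forall v, P v -> v \in U & \dim U = n >].
have exQ : exists n, Q n.
  by exists (\dim {:V}); apply/asboolP; exists fullv => // v _; rewrite memvf.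
case: (ex_minnP exQ) => n /asboolP[U PU dimU] minU.
exists U; split=> // W PW.
have /minU le_n : Q (\dim (U :&: W)).
  by apply/asboolP; exists (U :&: W)%VS => // v Pv; rewrite memv_cap PU ?PW.
by apply/capv_idPl/eqP; rewrite eqEdim capvSl dimU.
Qed.

(* The least subspace containing P; for a submodule-closed P its members are
   exactly the vectors satisfying P (vspan_closedP). *)
Definition vspan P : {vspace V} := sval (cid (vspan_subproof P)).

Lemma memv_vspan P v : P v -> v \in vspan P.
Proof. by rewrite /vspan; case: cid => U [/= + _] => /(_ v). Qed.

Lemma vspan_subvP P U : (vspan P <= U)%VS <-> forall v, P v -> v \in U.
Proof.
split=> [/subvP sPU v /memv_vspan /sPU//|].
by rewrite /vspan; case: cid => W [/= _]; apply.
Qed.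

Lemma vspan_closedP P : P 0 -> (forall a u v, P u -> P v -> P (a *: u + v)) ->
  forall v, v \in vspan P <-> P v.
Proof.
move=> P0 PD v; split; last exact: memv_vspan.
have PZ a u : P u -> P (a *: u) by move=> Pu; rewrite -[_ *: _]addr0; apply: PD.
pose Q n := `[< exists2 U : {vspace V}, forall v, v \in U -> P v & \dim U = n >].
have exQ : exists n, Q n.
  exists 0%N; apply/asboolP; exists 0%VS; last by rewrite dimv0.
  by move=> u; rewrite memv0 => /eqP->.
have leQ n : Q n -> (n <= \dim {:V})%N.
  by move=> /asboolP[U _ <-]; rewrite dimvS ?subvf.
case: (ex_maxnP exQ leQ) => n /asboolP[U UP dimU] maxU.
suff PU u : P u -> u \in U.
  by move=> /(subvP ((vspan_subvP P U).2 PU)); apply: UP.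
move=> Pu; have /maxU : Q (\dim (<[u]> + U)).
  apply/asboolP; exists (<[u]> + U)%VS => // w /memv_addP[_ /vlineP[a ->] [x /UP Px ->]].
  exact: PD.
rewrite -dimU => le_dim; have /eqP-> : U == (<[u]> + U)%VS by rewrite eqEdim addvSr.
by rewrite (subvP (addvSl _ _)) ?memv_line.
Qed.

End Span.

Definition quotv (F : fieldType) (V : vectType F) (U : {vspace V}) : Type :=
  Quotient.quot (pred_of_vspace U).

Section QuotientSpace.
Variables (F : fieldType) (V : vectType F) (U : {vspace V}).
Local Notation Q := (quotv U).

HB.instance Definition _ := GRing.Zmodule.on Q.

Definition piq (x : V) : Q := \pi_Q x.

Lemma piqP (x y : V) : piq x = piq y <-> x - y \in U.
Proof.
rewrite (Quotient.idealrBE (pred_of_vspace U)).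
by split=> [/eqP|/eqP].
Qed.

Lemma piq_repr (q : Q) : piq (repr q) = q.
Proof. exact: reprK. Qed.

Lemma piqB x y : piq (x - y) = piq x - piq y.
Proof. exact: (raddfB (\pi_(Quotient.quot (pred_of_vspace U)))). Qed.

Lemma piqD x y : piq (x + y) = piq x + piq y.
Proof. exact: (raddfD (\pi_(Quotient.quot (pred_of_vspace U)))). Qed.

Definition scaleq (a : F) (q : Q) : Q := piq (a *: repr q).

Lemma scaleq_pi a x : scaleq a (piq x) = piq (a *: x).
Proof. by apply/piqP; rewrite -scalerBr memvZ//; apply/piqP; rewrite piq_repr. Qed.

Fact scaleqA a b q : scaleq a (scaleq b q) = scaleq (a * b) q.
Proof. by rewrite -(piq_repr q) !scaleq_pi scalerA. Qed.
Fact scale1q : left_id 1 scaleq.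
Proof. by move=> q; rewrite -{2}(piq_repr q) /scaleq scale1r. Qed.
Fact scaleqDr : right_distributive scaleq +%R.
Proof.
move=> a q r; rewrite -(piq_repr q) -(piq_repr r).
by rewrite -piqD !scaleq_pi -piqD scalerDr.
Qed.
Fact scaleqDl q : {morph scaleq^~ q : a b / a + b}.
Proof. by move=> a b; rewrite -(piq_repr q) !scaleq_pi -piqD scalerDl. Qed.

HB.instance Definition _ := GRing.Zmodule_isLmodule.Build F Q
  scaleqA scale1q scaleqDr scaleqDl.

Fact piq_is_linear : linear piq.
Proof. by move=> a x y; rewrite piqD -scaleq_pi. Qed.
HB.instance Definition _ := GRing.isLinear.Build F V Q _ piq piq_is_linear.


(* Cosets of U are coordinatized by the complement of U. *)
Let toC (q : Q) : subvs_of (U^C)%VS :=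
  vsproj (U^C)%VS (daddv_pi (U^C) U (repr q)).

Let toC_pi x : toC (piq x) = vsproj (U^C)%VS (daddv_pi (U^C) U x).
Proof.
apply/eqP; rewrite -subr_eq0 /toC -!linearB /=; apply/eqP.
have xU : repr (piq x) - x \in U by apply/piqP; rewrite piq_repr.
have capCU : (U^C :&: U)%VS = 0%VS by rewrite capvC capv_compl.
have := daddv_pi_add (w := repr (piq x) - x) capCU.
rewrite addvC addv_complf memvf => /(_ isT).
rewrite [daddv_pi U _ _]daddv_pi_id ?capv_compl// => /eqP.
by rewrite addrC -subr_eq0 addrAC subrr add0r => /eqP->; rewrite linear0.
Qed.

Let toC_linear : linear toC.
Proof.
move=> a q r; rewrite -(piq_repr q) -(piq_repr r).
by rewrite -piq_is_linear !toC_pi !linearP.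
Qed.

Let toCK : cancel toC (fun w => piq (vsval w)).
Proof.
move=> q; rewrite -[in RHS](piq_repr q); apply/piqP; rewrite vsprojK ?memv_pi//.
have capCU : (U^C :&: U)%VS = 0%VS by rewrite capvC capv_compl.
have := daddv_pi_add (w := repr q) capCU.
rewrite addvC addv_complf memvf => /(_ isT) {2}<-.
by rewrite opprD addrA subrr add0r memvN memv_pi.
Qed.

Let piK : cancel (fun w => piq (vsval w)) toC.
Proof.
move=> w; rewrite toC_pi daddv_pi_id ?vsvalK ?subvsP//.
by rewrite capvC capv_compl.
Qed.

Fact quotv_vect_iso : Vector.axiom (\dim (U^C)) Q.
Proof.
exists (VectorInternalTheory.v2r \o toC).
  move=> a q r; rewrite [LHS]/= toC_linear /=.
  have [vZ vD] := v2r_semilinear (VectorInternalTheory.v2r_subproof (subvs_of U^C)).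
  by rewrite [LHS]vD vZ.
apply: bij_comp; last by exists (fun w => piq (vsval w)).
exact: v2r_bijective (VectorInternalTheory.v2r_subproof (subvs_of U^C)).
Qed.
HB.instance Definition _ := Lmodule_hasFinDim.Build F Q quotv_vect_iso.

Lemma dim_quotv : \dim {:Q} = (\dim {:V} - \dim U)%N.
Proof. by rewrite dimvf /dim /= dimv_compl. Qed.

End QuotientSpace.

HB.mixin Record Lmodule_isDiassociative (F : fieldType) (L : Type)
    of GRing.Lmodule F L := {
  dmull : L -> L -> L;
  dmulr : L -> L -> L;
  dmull_linearl : forall z, linear (dmull^~ z);
  dmull_linearr : forall x, linear (dmull x);
  dmulr_linearl : forall z, linear (dmulr^~ z);
  dmulr_linearr : forall x, linear (dmulr x);
  dmullA : forall x y z, dmull x (dmull y z) = dmull (dmull x y) z;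
  dmulrA : forall x y z, dmulr x (dmulr y z) = dmulr (dmulr x y) z;
  dmull_lr : forall x y z, dmull x (dmull y z) = dmull x (dmulr y z);
  dmulrl_A : forall x y z, dmull (dmulr x y) z = dmulr x (dmull y z);
  dmulr_lr : forall x y z, dmulr (dmull x y) z = dmulr (dmulr x y) z }.

(* finite-dimensional diassociative algebras over F *)
#[short(type="diassType")]
HB.structure Definition Diass (F : fieldType) :=
  { L of Lmodule_isDiassociative F L & Vector F L }.

Notation "x ⊣ y" := (dmull x y) : ring_scope.
Notation "x ⊢ y" := (dmulr x y) : ring_scope.

Section DiassTheory.
Variables (F : fieldType) (L : diassType F).
Implicit Types (x y z : L) (X Y : {vspace L}).

Section Linearity.
Variable z : L.
HB.instance Definition _ := GRing.isLinear.Build F L L _ (dmull z) (dmull_linearr z).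
HB.instance Definition _ := GRing.isLinear.Build F L L _ (dmulr z) (dmulr_linearr z).
End Linearity.

Lemma dmullPl a x y z : (a *: x + y) ⊣ z = a *: (x ⊣ z) + y ⊣ z.
Proof. exact: dmull_linearl. Qed.
Lemma dmullPr a x y z : z ⊣ (a *: x + y) = a *: (z ⊣ x) + z ⊣ y.
Proof. exact: dmull_linearr. Qed.
Lemma dmulrPl a x y z : (a *: x + y) ⊢ z = a *: (x ⊢ z) + y ⊢ z.
Proof. exact: dmulr_linearl. Qed.
Lemma dmulrPr a x y z : z ⊢ (a *: x + y) = a *: (z ⊢ x) + z ⊢ y.
Proof. exact: dmulr_linearr. Qed.
Definition dmulP := (dmullPl, dmullPr, dmulrPl, dmulrPr).

Lemma dmul0 x : [/\ 0 ⊣ x = 0, 0 ⊢ x = 0, x ⊣ 0 = 0 & x ⊢ 0 = 0].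
Proof.
have E0 : 0 = (-1) *: 0 + 0 :> L by rewrite scaler0 addr0.
by split; rewrite 1?[in LHS]E0 ?dmulP ?scaleN1r ?addNr ?linear0.
Qed.

Lemma dmullBl x y z : (x - y) ⊣ z = x ⊣ z - y ⊣ z.
Proof. by rewrite -scaleN1r addrC dmullPl scaleN1r addrC. Qed.
Lemma dmullBr x y z : z ⊣ (x - y) = z ⊣ x - z ⊣ y.
Proof. exact: linearB. Qed.
Lemma dmulrBl x y z : (x - y) ⊢ z = x ⊢ z - y ⊢ z.
Proof. by rewrite -scaleN1r addrC dmulrPl scaleN1r addrC. Qed.
Lemma dmulrBr x y z : z ⊢ (x - y) = z ⊢ x - z ⊢ y.
Proof. exact: linearB. Qed.

Definition ldprod X Y : {vspace L} :=
  vspan (fun v => exists x y, [/\ x \in X, y \in Y & v = x ⊣ y]).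
Definition rdprod X Y : {vspace L} :=
  vspan (fun v => exists x y, [/\ x \in X, y \in Y & v = x ⊢ y]).
Definition lozenge X Y : {vspace L} := (ldprod X Y + rdprod X Y)%VS.

Lemma memv_lozengel X Y x y : x \in X -> y \in Y -> x ⊣ y \in lozenge X Y.
Proof.
move=> xX yY; apply/(subvP (addvSl _ _)).
by apply: memv_vspan; exists x, y.
Qed.

Lemma memv_lozenger X Y x y : x \in X -> y \in Y -> x ⊢ y \in lozenge X Y.
Proof.
move=> xX yY; apply/(subvP (addvSr _ _)).
by apply: memv_vspan; exists x, y.
Qed.

Lemma lozenge_subv X Y (U : {vspace L}) :
  (forall x y, x \in X -> y \in Y -> (x ⊣ y \in U) /\ (x ⊢ y \in U)) ->
  (lozenge X Y <= U)%VS.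
Proof.
move=> XYU; rewrite subv_add; apply/andP.
by split; apply/vspan_subvP => _ [x [y [xX yY ->]]]; case: (XYU x y).
Qed.

Lemma lozengeS X X' Y Y' : (X <= X')%VS -> (Y <= Y')%VS ->
  (lozenge X Y <= lozenge X' Y')%VS.
Proof.
move=> /subvP sX /subvP sY; apply: lozenge_subv => x y /sX xX /sY yY.
by rewrite memv_lozengel ?memv_lozenger.
Qed.

(* The sequence [:: L^1; ...; L^(k+1)]; entry i is L^(i+1). *)
Fixpoint lcs_seq k : seq {vspace L} :=
  if k is k'.+1 then
    let s := lcs_seq k' in
    rcons s (\sum_(i < k) lozenge (nth fullv s i) (nth fullv s (k' - i)))%VS
  else [:: fullv].

(* L^n for n >= 1; lcs 0 = L^1 is never used. *)
Definition lcs n : {vspace L} := nth fullv (lcs_seq n.-1) n.-1.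

Lemma size_lcs_seq k : size (lcs_seq k) = k.+1.
Proof. by elim: k => //= k IHk; rewrite size_rcons IHk. Qed.

Lemma nth_lcs_seq k i : (i <= k)%N -> nth fullv (lcs_seq k) i = lcs i.+1.
Proof.
elim: k => [|k IHk]; first by rewrite leqn0 => /eqP->.
rewrite leq_eqVlt => /predU1P[->//|lt_ik].
by rewrite /= nth_rcons size_lcs_seq lt_ik IHk.
Qed.

Lemma lcs1 : lcs 1 = fullv. Proof. by []. Qed.

Lemma lcsS k : (0 < k)%N ->
  lcs k.+1 = (\sum_(1 <= i < k.+1) lozenge (lcs i) (lcs (k.+1 - i)))%VS.
Proof.
case: k => // k _; rewrite big_add1 /= big_mkord {1}/lcs /=.
rewrite nth_rcons size_lcs_seq ltnn eqxx; apply: eq_bigr => i _.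
have le_ik : (i <= k)%N by rewrite -ltnS.
by rewrite !nth_lcs_seq ?leq_subr // subSS subSn.
Qed.

Definition nilpotent_of_class n : Prop :=
  [/\ (0 < n)%N, lcs n != 0%VS & lcs n.+1 = 0%VS].

Definition center : {vspace L} := vspan (fun z =>
  forall x, [/\ z ⊣ x = 0, z ⊢ x = 0, x ⊣ z = 0 & x ⊢ z = 0]).

Fixpoint ucs j : {vspace L} :=
  if j is j'.+1 then vspan (fun x => forall l,
    [/\ x ⊣ l \in ucs j', x ⊢ l \in ucs j', l ⊣ x \in ucs j' & l ⊢ x \in ucs j'])
  else 0%VS.

Lemma ucsP j x : x \in ucs j.+1 <-> forall l,
  [/\ x ⊣ l \in ucs j, x ⊢ l \in ucs j, l ⊣ x \in ucs j & l ⊢ x \in ucs j].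
Proof.
apply: vspan_closedP => [l|a u v Hu Hv l].
  by case: (dmul0 l) => -> -> -> ->; split; rewrite mem0v.
by case: (Hu l) (Hv l) => ? ? ? ? [? ? ? ?]; rewrite !dmulP; split; rewrite memvD ?memvZ.
Qed.

Lemma centerP z : z \in center <->
  forall x, [/\ z ⊣ x = 0, z ⊢ x = 0, x ⊣ z = 0 & x ⊢ z = 0].
Proof.
apply: vspan_closedP => [l|a u v Hu Hv l]; first exact: dmul0.
case: (Hu l) (Hv l) => e1 e2 e3 e4 [f1 f2 f3 f4].
by rewrite !dmulP e1 e2 e3 e4 f1 f2 f3 f4 scaler0 addr0.
Qed.

Lemma ucs1 : ucs 1 = center.
Proof.
apply/vspaceP => z; apply/idP/idP.
  move=> /ucsP Hz; apply/centerP => x; case: (Hz x) => /=.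
  by rewrite !memv0 => /eqP-> /eqP-> /eqP-> /eqP->.
move=> /centerP Hz; apply/ucsP => x /=; case: (Hz x) => -> -> -> ->.
by rewrite mem0v.
Qed.

Definition diass_ideal (I : {vspace L}) : Prop := forall x l, x \in I ->
  [/\ x ⊣ l \in I, x ⊢ l \in I, l ⊣ x \in I & l ⊢ x \in I].

Record dideal :=
  DIdeal { dideal_space :> {vspace L}; dideal_proof : diass_ideal dideal_space }.

Lemma lcs_decr n : (lcs n.+1 <= lcs n)%VS.
Proof.
have [k] := ubnP n; elim: k n => // k IHk [|[|n]] /ltnSE lt_nk; rewrite ?subvf//.
rewrite lcsS // big_nat_recl // subSS subn0.
have le1 : (lozenge (lcs 1) (lcs n.+2) <= lcs n.+2)%VS.
  apply: (subv_trans (lozengeS (subvv _) (IHk n.+1 lt_nk))).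
  by rewrite [X in (_ <= X)%VS]lcsS // big_nat_recl // subSS subn0 addvSl.
rewrite subv_add le1 big_nat.
apply: (big_ind (fun U => U <= lcs n.+2)%VS) => [|U W sU sW|i /andP[i_gt0 le_in]].
- by rewrite sub0v.
- by rewrite subv_add sU.
have le2 : (lcs i.+1 <= lcs i)%VS by apply: IHk; apply: leq_trans lt_nk.
apply: subv_trans (lozengeS le2 (subvv _)) _; rewrite subSS.
rewrite [X in (_ <= X)%VS]lcsS // (bigD1_seq i) ?iota_uniq ?mem_index_iota ?i_gt0//=.
exact: addvSl.
Qed.

Lemma lcs_ideal_proof n : diass_ideal (lcs n).
Proof.
case: n => [|n] x l Ix; first by rewrite !memvf.
have /subvP sub := lcs_decr n.+1.
have lI : (lozenge (lcs n.+1) fullv <= lcs n.+2)%VS.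
  by rewrite [lcs n.+2]lcsS // big_nat_recr // subSnn addvSr.
have rI : (lozenge fullv (lcs n.+1) <= lcs n.+2)%VS.
  by rewrite [lcs n.+2]lcsS // big_nat_recl // subSS subn0 addvSl.
by split; apply: sub; [apply: (subvP lI)| apply: (subvP lI)
  | apply: (subvP rI) | apply: (subvP rI)];
  rewrite ?memv_lozengel ?memv_lozenger ?memvf.
Qed.

Definition lcs_ideal n : dideal := DIdeal (@lcs_ideal_proof n).

End DiassTheory.

Arguments lcs {F} L n.
Arguments ucs {F} L j.
Arguments center {F} L.
Arguments nilpotent_of_class {F} L n.
Arguments lcs_ideal {F} L n.

Definition dquot (F : fieldType) (L : diassType F) (I : dideal L) : Type :=
  quotv I.

Section QuotientAlgebra.
Variables (F : fieldType) (L : diassType F) (I : dideal L).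
Local Notation Q := (dquot I).

HB.instance Definition _ := Vector.on Q.

Definition pid (x : L) : Q := piq I x.
Let pidD a x y : pid (a *: x + y) = a *: pid x + pid y.
Proof. exact: piq_is_linear. Qed.

Definition ldmulq (p q : Q) : Q := pid (repr p ⊣ repr q).
Definition rdmulq (p q : Q) : Q := pid (repr p ⊢ repr q).

Lemma ldmulq_pi x y : ldmulq (pid x) (pid y) = pid (x ⊣ y).
Proof.
apply/piqP; set x' := repr _; set y' := repr _.
have xI : x' - x \in I by apply/piqP; rewrite piq_repr.
have yI : y' - y \in I by apply/piqP; rewrite piq_repr.
have -> : x' ⊣ y' - x ⊣ y = (x' - x) ⊣ y' + x ⊣ (y' - y).
  by rewrite dmullBl dmullBr addrA subrK.
by apply: memvD; [case: (dideal_proof y' xI) | case: (dideal_proof x yI)].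
Qed.

Lemma rdmulq_pi x y : rdmulq (pid x) (pid y) = pid (x ⊢ y).
Proof.
apply/piqP; set x' := repr _; set y' := repr _.
have xI : x' - x \in I by apply/piqP; rewrite piq_repr.
have yI : y' - y \in I by apply/piqP; rewrite piq_repr.
have -> : x' ⊢ y' - x ⊢ y = (x' - x) ⊢ y' + x ⊢ (y' - y).
  by rewrite dmulrBl dmulrBr addrA subrK.
by apply: memvD; [case: (dideal_proof y' xI) | case: (dideal_proof x yI)].
Qed.

Let pidP (q : Q) : {x | pid x = q}.
Proof. by exists (repr q); apply: piq_repr. Qed.

Fact ldmulq_linearl r : linear (ldmulq^~ r).
Proof.
move=> a p q; case: (pidP p) (pidP q) (pidP r) => [x <-] [y <-] [z <-].
by rewrite -pidD !ldmulq_pi -pidD dmull_linearl.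
Qed.
Fact ldmulq_linearr r : linear (ldmulq r).
Proof.
move=> a p q; case: (pidP p) (pidP q) (pidP r) => [x <-] [y <-] [z <-].
by rewrite -pidD !ldmulq_pi -pidD dmull_linearr.
Qed.
Fact rdmulq_linearl r : linear (rdmulq^~ r).
Proof.
move=> a p q; case: (pidP p) (pidP q) (pidP r) => [x <-] [y <-] [z <-].
by rewrite -pidD !rdmulq_pi -pidD dmulr_linearl.
Qed.
Fact rdmulq_linearr r : linear (rdmulq r).
Proof.
move=> a p q; case: (pidP p) (pidP q) (pidP r) => [x <-] [y <-] [z <-].
by rewrite -pidD !rdmulq_pi -pidD dmulr_linearr.
Qed.
Fact ldmulqA p q r : ldmulq p (ldmulq q r) = ldmulq (ldmulq p q) r.
Proof.
case: (pidP p) (pidP q) (pidP r) => [x <-] [y <-] [z <-].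
by rewrite !ldmulq_pi dmullA.
Qed.
Fact rdmulqA p q r : rdmulq p (rdmulq q r) = rdmulq (rdmulq p q) r.
Proof.
case: (pidP p) (pidP q) (pidP r) => [x <-] [y <-] [z <-].
by rewrite !rdmulq_pi dmulrA.
Qed.
Fact ldmulq_lr p q r : ldmulq p (ldmulq q r) = ldmulq p (rdmulq q r).
Proof.
case: (pidP p) (pidP q) (pidP r) => [x <-] [y <-] [z <-].
by rewrite !(ldmulq_pi, rdmulq_pi) dmull_lr.
Qed.
Fact rldmulqA p q r : ldmulq (rdmulq p q) r = rdmulq p (ldmulq q r).
Proof.
case: (pidP p) (pidP q) (pidP r) => [x <-] [y <-] [z <-].
by rewrite !(ldmulq_pi, rdmulq_pi) dmulrl_A.
Qed.
Fact rdmulq_lr p q r : rdmulq (ldmulq p q) r = rdmulq (rdmulq p q) r.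
Proof.
case: (pidP p) (pidP q) (pidP r) => [x <-] [y <-] [z <-].
by rewrite !(ldmulq_pi, rdmulq_pi) dmulr_lr.
Qed.

HB.instance Definition _ := Lmodule_isDiassociative.Build F Q
  ldmulq_linearl ldmulq_linearr rdmulq_linearl rdmulq_linearr
  ldmulqA rdmulqA ldmulq_lr rldmulqA rdmulq_lr.

End QuotientAlgebra.

Section Cohomology.
Variables (F : fieldType) (Q : diassType F).

Definition bilform : vectType F := 'Hom(Q, 'Hom(Q, F^o)).
Definition bilpair : vectType F := (bilform * bilform)%type.
Implicit Types f : bilpair.

(* f = (f_⊣, f_⊢) *)
Definition is_cocycle f : Prop := forall i j k : Q,
  [/\ f.1 i (j ⊣ k) = f.1 i (j ⊢ k),
      f.1 (i ⊢ j) k = f.2 i (j ⊣ k),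
      f.2 (i ⊣ j) k = f.2 (i ⊢ j) k,
      f.1 i (j ⊣ k) = f.1 (i ⊣ j) k
    & f.2 i (j ⊢ k) = f.2 (i ⊢ j) k].

Definition is_coboundary f : Prop := exists eps : 'Hom(Q, F^o),
  forall x y : Q, f.1 x y = - eps (x ⊣ y) /\ f.2 x y = - eps (x ⊢ y).

Definition Z2 : {vspace bilpair} := vspan is_cocycle.
Definition B2 : {vspace bilpair} := vspan is_coboundary.

Let fE1 a f g x y : (a *: f + g).1 x y = a * f.1 x y + g.1 x y.
Proof. by rewrite /= !(add_lfunE, scale_lfunE, zero_lfunE). Qed.
Let fE2 a f g x y : (a *: f + g).2 x y = a * f.2 x y + g.2 x y.
Proof. by rewrite /= !(add_lfunE, scale_lfunE, zero_lfunE). Qed.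

Lemma Z2P f : f \in Z2 <-> is_cocycle f.
Proof.
apply: vspan_closedP => [i j k|a u v Hu Hv i j k].
  by rewrite /= !(add_lfunE, scale_lfunE, zero_lfunE).
case: (Hu i j k) (Hv i j k) => e1 e2 e3 e4 e5 [g1 g2 g3 g4 g5].
by rewrite !fE1 !fE2; split; congr (_ * _ + _).
Qed.

Lemma B2P f : f \in B2 <-> is_coboundary f.
Proof.
apply: vspan_closedP => [|a u v [e He] [d Hd]].
  by exists 0 => x y; rewrite /= !(add_lfunE, scale_lfunE, zero_lfunE) oppr0.
exists (a *: e + d) => x y; rewrite fE1 fE2.
case: (He x y) (Hd x y) => -> -> [-> ->].
by rewrite !(add_lfunE, scale_lfunE, zero_lfunE) !mulrN !opprD.
Qed.

Lemma B2_sub_Z2 : (B2 <= Z2)%VS.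
Proof.
apply/subvP => f /B2P[e He]; apply/Z2P => i j k.
have E1 x y := (He x y).1; have E2 x y := (He x y).2.
by rewrite !E1 !E2 dmull_lr dmulrl_A dmulr_lr -dmullA dmull_lr dmulrA.
Qed.

(* B2 viewed as a subspace of the space Z2 *)
Definition B2_in_Z2 : {vspace subvs_of Z2} := (linfun vsval @^-1: B2)%VS.

Definition H2 : vectType F := quotv B2_in_Z2.

End Cohomology.

Arguments Z2 {F} Q.
Arguments B2 {F} Q.
Arguments H2 {F} Q.

(* Main.v *)
Require Import Defs.
From mathcomp Require Import all_boot all_order all_algebra.
From mathcomp Require Import zify.
From HB Require Import structures.

Import Order.TTheory GRing.Theory Num.Theory.
Local Open Scope ring_scope.

(** Write [Z = L^n] and [Q = L/Z]. The inequality combines two comparisons.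

    Cocycles ([dim_Z2_quotient]). A cocycle [f] of [L] is inflated from [Q] as
    soon as it vanishes when one of its arguments is in [Z]
    ([cocycle_descent]), so [dim Z^2(L) - dim Z^2(Q)] is at most the rank of
    the restriction of [f.1] and [f.2] to [Z * L] and [L * Z]. These four
    forms only depend on [L] modulo [Z_(n-1)], because [f] vanishes on
    [L^n * Z_(n-1)] and on [Z_(n-1) * L^n] ([cocycle_lcs_ucs]): this is the
    usual duality of the two central series, which holds here because the
    axioms let a product [(a * b) * x] be computed as [a * (b * x)], and
    [x * (a * b)] as [(x * a) * b], for suitable choices of the operations.
    So the rank is at most [4 dim(Z) dim(L/Z_(n-1))].

    Coboundaries ([dim_B2_quotient]). If [n > 1] then [Z] lies in [L^2], so a
    linear form on [L] with zero coboundary vanishes on [Z]; hence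
    [dim B^2(L)] exceeds [dim B^2(Q)] by at least [dim Z].

    If [n = 1] then [Z = L] and [Z_0 = 0], and the bound follows from
    [dim Z^2(L) <= 2 (dim L)^2]. *)

Set Implicit Arguments.
Unset Strict Implicit.
Unset Printing Implicit Defensive.

(** * Linear algebra *)

(** [lfunE] for a function with an unbundled proof of linearity. *)
Lemma linfunE (F : fieldType) (V W : vectType F) (f : V -> W) :
  linear f -> linfun f =1 f.
Proof.
move=> fL.
pose f' : {linear V -> W} := HB.pack f (GRing.isLinear.Build F V W *:%R f fL).
exact: (lfunE f').
Qed.

(** A bilinear map [b] as an iterated linear map; the values of [bilfun b] are
    those of [b] only if [b] is bilinear ([bilfunE]). *)
Definition bilfun (F : fieldType) (V : vectType F) (b : V -> V -> F^o) :
  'Hom(V, 'Hom(V, F^o)) := linfun (fun x => linfun (b x)).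

Lemma bilfunE (F : fieldType) (V : vectType F) (b : V -> V -> F^o) :
    (forall y, linear (b^~ y)) -> (forall x, linear (b x)) ->
  forall x y, bilfun b x y = b x y.
Proof.
move=> bl br x y; rewrite [bilfun b x]linfunE; first by rewrite linfunE.
move=> a u v; apply/lfunP => z; rewrite add_lfunE scale_lfunE.
by rewrite !linfunE //; apply: bl.
Qed.

Section LinearAlgebra.
Variables (F : fieldType) (V W : vectType F).

Lemma dim_le_ker_codomain (g : 'Hom(V, W)) (U K : {vspace V}) :
  (forall v, v \in U -> g v = 0 -> v \in K) -> (\dim U <= \dim K + \dim {:W})%N.
Proof.
move=> sub; rewrite -(limg_ker_dim g U) leq_add ?dimvS ?subvf //.
by apply/subvP => v; rewrite memv_cap memv_ker => /andP[vU /eqP]; apply: sub.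
Qed.

Local Notation bil := 'Hom(V, 'Hom(V, F^o)).

(** The matrix of a bilinear form on the bases [vbasis] of two subspaces. *)
Definition gram_mx (X Y : {vspace V}) (f : bil) : 'M[F]_(\dim X, \dim Y) :=
  \matrix_(i, j) f (vbasis X)`_i (vbasis Y)`_j.

Lemma gram_mx_is_linear X Y : linear (gram_mx X Y).
Proof.
move=> a f g; apply/matrixP => i j.
by rewrite !mxE !(add_lfunE, scale_lfunE).
Qed.

Lemma gram_mx_eq0 X Y (f : bil) x y :
  gram_mx X Y f = 0 -> x \in X -> y \in Y -> f x y = 0.
Proof.
move=> /matrixP f0 /coord_vbasis-> /coord_vbasis->.
rewrite linear_sum big1 // => j _; rewrite linearZ /=.
rewrite linear_sum sum_lfunE big1 ?scaler0 // => i _; rewrite linearZ scale_lfunE.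
by have := f0 i j; rewrite !mxE => ->; rewrite scaler0.
Qed.

(** The pull-back of a bilinear form on [W] along a linear map [h : V -> W]. *)
Definition bil_pull (h : 'Hom(V, W)) (f : 'Hom(W, 'Hom(W, F^o))) : bil :=
  bilfun (fun x y => f (h x) (h y)).

Lemma bil_pullE h f x y : bil_pull h f x y = f (h x) (h y).
Proof.
apply: bilfunE => u a v w; first by rewrite linearP [f _]linearP add_lfunE scale_lfunE.
by rewrite !linearP.
Qed.

Lemma dim_pair : \dim {:(V * W)%type} = (\dim {:V} + \dim {:W})%N.
Proof. by rewrite !dimvf. Qed.

Lemma dim_hom : \dim {:'Hom(V, W)} = (\dim {:V} * \dim {:W})%N.
Proof. by rewrite !dimvf. Qed.

Lemma dim_form : \dim {:'Hom(V, F^o)} = \dim {:V}.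
Proof. by rewrite !dimvf /dim /= muln1. Qed.

End LinearAlgebra.

(** * Products of the two central series *)

Section CentralSeries.
Variables (F : fieldType) (L : diassType F).

Implicit Types (P : L -> Prop) (i j k : nat).

(** [L^k], for [k > 1], is the least subspace containing all the products
    of [L^i] and [L^j] with [i + j = k]. *)
Lemma lcs_ind P k :
    P 0 -> (forall a u v, P u -> P v -> P (a *: u + v)) ->
    (forall i j x y, (0 < i)%N -> (0 < j)%N -> (i + j)%N = k ->
       x \in lcs L i -> y \in lcs L j -> P (x ⊣ y) /\ P (x ⊢ y)) ->
  (1 < k)%N -> forall z, z \in lcs L k -> P z.
Proof.
case: k => [|k] P0 PD Pprod //; rewrite ltnS => k_gt0 z zL.
apply/(vspan_closedP P0 PD); move: z zL; apply/subvP; rewrite lcsS // big_nat.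
apply: (big_ind (fun U => U <= vspan P)%VS) => [|A B sA sB|i /andP[i0 ltik]].
- exact: sub0v.
- by rewrite subv_add sA.
apply: lozenge_subv => x y xL yL.
have [||? ?] := Pprod i (k.+1 - i)%N x y i0 _ _ xL yL.
- by rewrite subn_gt0.
- by rewrite subnKC // ltnW.
by split; apply: memv_vspan.
Qed.

(** [L^k ◊ Z_j] and [Z_j ◊ L^k] lie in [Z_(j-k)]: by diassociativity, each
    product of [a * b] with [x] is obtained by multiplying [x] by [a] and
    by [b], one after the other. The subtraction is truncated: the products
    vanish for [j <= k]. *)
Lemma lcs_ucs k j z x : (0 < k)%N -> z \in lcs L k -> x \in ucs L j ->
  [/\ x ⊣ z \in ucs L (j - k), x ⊢ z \in ucs L (j - k),
      z ⊣ x \in ucs L (j - k) & z ⊢ x \in ucs L (j - k)].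
Proof.
elim/ltn_ind: k j z x => k IHk j z x k_gt0.
have [k1|k_gt1] := leqP k 1.
  have -> : k = 1%N by apply/eqP; rewrite eqn_leq k1.
  move=> _; case: j => [|j]; last by move=> /ucsP /(_ z); rewrite subSS subn0.
  rewrite memv0 => /eqP->; case: (dmul0 z) => -> -> -> ->.
  by rewrite mem0v.
move=> zL xZ; move: k_gt1 z zL; apply: lcs_ind.
- by case: (dmul0 x) => -> -> -> ->; rewrite mem0v.
- move=> a u v [u1 u2 u3 u4] [v1 v2 v3 v4].
  by rewrite !dmulP; split; rewrite memvD ?memvZ.
move=> p q a b p0 q0 def_k aL bL.
have ltpk : (p < k)%N by rewrite -def_k -{1}[p]addn0 ltn_add2l.
have ltqk : (q < k)%N by rewrite -def_k -{1}[q]add0n ltn_add2r.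
have [xa1 xa2 _ _] := IHk p ltpk j a x p0 aL xZ.
have [_ _ bx1 bx2] := IHk q ltqk j b x q0 bL xZ.
have right y : y \in ucs L (j - p) ->
    [/\ y ⊣ b \in ucs L (j - k) & y ⊢ b \in ucs L (j - k)].
  by move=> yZ; rewrite -def_k subnDA; case: (IHk q ltqk (j - p)%N b y).
have left y : y \in ucs L (j - q) ->
    [/\ a ⊣ y \in ucs L (j - k) & a ⊢ y \in ucs L (j - k)].
  by move=> yZ; rewrite -def_k addnC subnDA; case: (IHk p ltpk (j - q)%N a y).
have [r1 _] := right _ xa1; have [r3 r4] := right _ xa2.
have [l1 l2] := left _ bx1; have [_ l4] := left _ bx2.
split; split.
- by rewrite dmullA.
- by rewrite -dmulrl_A.
- by rewrite -dmullA.
- by rewrite dmulr_lr -dmulrA.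
- by rewrite -dmull_lr dmullA.
- by rewrite dmulrA.
- by rewrite dmulrl_A.
- by rewrite -dmulrA.
Qed.

(** The same shift, for a cocycle in place of the product: it reflects
    the vanishing of [M^k ◊ Z_(j+1)(M)], for [j < k], in the central extension
    [M] of [L] by the field that the cocycle defines, where [Z_j(L)] lifts to
    [Z_(j+1)(M)]. *)
Lemma cocycle_lcs_ucs f k j z x : is_cocycle f -> (j < k)%N ->
    z \in lcs L k -> x \in ucs L j ->
  [/\ f.1 z x = 0, f.1 x z = 0, f.2 z x = 0 & f.2 x z = 0].
Proof.
move=> Zf; elim/ltn_ind: k j z x => k IHk j z x ltjk zL xZ.
have f0 y : [/\ f.1 y 0 = 0, f.1 0 y = 0, f.2 y 0 = 0 & f.2 0 y = 0].
  by rewrite !linear0 !zero_lfunE.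
have [k1|k_gt1] := leqP k 1.
  have j0 : j = 0%N by case: j ltjk k1 {xZ} => // j; case: k {IHk zL} => [|[]].
  by move: xZ; rewrite j0 memv0 => /eqP->.
move: k_gt1 z zL; apply: lcs_ind => [|a u v [u1 u2 u3 u4] [v1 v2 v3 v4]|].
- by case: (f0 x).
- rewrite !linearP !(add_lfunE, scale_lfunE) /= u1 u2 u3 u4 v1 v2 v3 v4.
  by rewrite !scaler0 !addr0.
move=> p q a b p0 q0 def_k aL bL.
have ltpk : (p < k)%N by rewrite -def_k -{1}[p]addn0 ltn_add2l.
have ltqk : (q < k)%N by rewrite -def_k -{1}[q]add0n ltn_add2r.
have [xa1 xa2 _ _] := lcs_ucs p0 aL xZ.
have [_ _ bx1 bx2] := lcs_ucs q0 bL xZ.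
have ltp : (j - q < p)%N by lia.
have ltq : (j - p < q)%N by lia.
have right y : y \in ucs L (j - p) -> f.1 y b = 0 /\ f.2 y b = 0.
  by move=> yZ; case: (IHk q ltqk _ b y ltq bL yZ).
have left y : y \in ucs L (j - q) -> f.1 a y = 0 /\ f.2 a y = 0.
  by move=> yZ; case: (IHk p ltpk _ a y ltp aL yZ).
have [r1 _] := right _ xa1; have [r3 r4] := right _ xa2.
have [l1 l2] := left _ bx1; have [_ l4] := left _ bx2.
have [c1 c2 c3 c4 c5] := Zf a b x; have [d1 d2 d3 d4 d5] := Zf x a b.
split; split.
- by rewrite -c4.
- by rewrite d4.
- by rewrite c3 -c5.
- by rewrite -d2.
- by rewrite c2.
- by rewrite -d1 d4.
- by rewrite -c5.
- by rewrite d5.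
Qed.

Lemma lcs_sub2 k : (1 < k)%N -> (lcs L k <= lcs L 2)%VS.
Proof.
case: k => [|[|k]] // _; elim: k => [|k IHk]; first exact: subvv.
exact: subv_trans (lcs_decr _ _) IHk.
Qed.

End CentralSeries.

(** * Cocycles and coboundaries *)

Section Cohomology.
Variables (F : fieldType) (L : diassType F).

Lemma bilpairP (f g : bilpair L) :
  (forall x y, f.1 x y = g.1 x y /\ f.2 x y = g.2 x y) -> f = g.
Proof.
move=> fg; apply: injective_projections; apply/lfunP => x; apply/lfunP => y;
  by case: (fg x y).
Qed.

Lemma bilpair_fstP a (f g : bilpair L) x y :
  (a *: f + g).1 x y = a * f.1 x y + g.1 x y.
Proof. by rewrite /= !(add_lfunE, scale_lfunE). Qed.

Lemma bilpair_sndP a (f g : bilpair L) x y :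
  (a *: f + g).2 x y = a * f.2 x y + g.2 x y.
Proof. by rewrite /= !(add_lfunE, scale_lfunE). Qed.

Lemma dim_H2 : \dim {:H2 L} = (\dim (Z2 L) - \dim (B2 L))%N.
Proof.
have inj : lker (linfun (vsval : subvs_of (Z2 L) -> bilpair L)) == 0%VS.
  by apply/lker0P => u v; rewrite !lfunE => /val_inj.
rewrite dim_quotv dimvf /dim /=; congr (_ - _)%N.
rewrite -(limg_dim_eq (f := linfun vsval) (U := B2_in_Z2 L)); last first.
  by rewrite (eqP inj) capv0.
rewrite lpreimK //; apply/subvP => f fB.
have fZ := subvP (B2_sub_Z2 L) f fB.
by rewrite -(vsprojK fZ) -[vsval _](lfunE vsval) memv_img ?memvf.
Qed.

(** The two components of the coboundary map [cob]. *)
Definition cobl (eps : 'Hom(L, F^o)) : bilform L :=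
  bilfun (fun x y => - eps (x ⊣ y)).
Definition cobr (eps : 'Hom(L, F^o)) : bilform L :=
  bilfun (fun x y => - eps (x ⊢ y)).

Lemma coblE eps x y : cobl eps x y = - eps (x ⊣ y).
Proof.
by apply: bilfunE => u a v w; rewrite dmulP linearP opprD scalerN.
Qed.
Lemma cobrE eps x y : cobr eps x y = - eps (x ⊢ y).
Proof.
by apply: bilfunE => u a v w; rewrite dmulP linearP opprD scalerN.
Qed.

(** The coboundary map on linear forms. *)
Definition cob (eps : 'Hom(L, F^o)) : bilpair L := (cobl eps, cobr eps).

Lemma cob_is_linear : linear cob.
Proof.
move=> a d e; apply/bilpairP => x y; rewrite bilpair_fstP bilpair_sndP.
by rewrite !(coblE, cobrE) !(add_lfunE, scale_lfunE) !opprD !mulrN.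
Qed.

Lemma limg_cob : limg (linfun cob) = B2 L.
Proof.
apply/vspaceP => f; apply/idP/idP => [/memv_imgP[e _ ->]|/B2P[e fe]].
  by apply/B2P; exists e => x y; rewrite linfunE ?coblE ?cobrE //; apply: cob_is_linear.
suff -> : f = linfun cob e by rewrite memv_img ?memvf.
rewrite linfunE; last exact: cob_is_linear.
by apply/bilpairP => x y; rewrite coblE cobrE.
Qed.

End Cohomology.

(** * Passage to the quotient *)

Section Quotient.
Variables (F : fieldType) (L : diassType F) (I : dideal L).
Local Notation Q := (dquot I).

(** [pid I], bundled as a linear map. *)
Definition proj : 'Hom(L, Q) := linfun (@pid F L I).

Lemma projE x : proj x = pid I x.
Proof. by rewrite linfunE //; apply: piq_is_linear. Qed.

Lemma proj_repr (q : Q) : proj (repr q) = q.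
Proof. by rewrite projE; apply: piq_repr. Qed.

Lemma limg_proj : limg proj = fullv.
Proof.
apply/vspaceP => q; rewrite memvf -[q]proj_repr.
by rewrite memv_img ?memvf.
Qed.

Lemma proj_dmull x y : proj (x ⊣ y) = proj x ⊣ proj y.
Proof. by rewrite !projE; apply/esym/ldmulq_pi. Qed.

Lemma proj_dmulr x y : proj (x ⊢ y) = proj x ⊢ proj y.
Proof. by rewrite !projE; apply/esym/rdmulq_pi. Qed.

(** A linear section of the projection. *)
Definition sec : 'Hom(Q, L) := (proj^-1)%VF.

Lemma secK q : proj (sec q) = q.
Proof. by rewrite limg_lfunVK // limg_proj memvf. Qed.

Lemma sec_proj x : sec (proj x) - x \in dideal_space I.
Proof. by apply/piqP; have := secK (proj x); rewrite !projE. Qed.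

(** Inflation of pairs of forms from [Q] to [L]. *)
Definition infl (g : bilpair Q) : bilpair L :=
  (bil_pull proj g.1, bil_pull proj g.2).

Lemma infl1E g x y : (infl g).1 x y = g.1 (proj x) (proj y).
Proof. exact: bil_pullE. Qed.
Lemma infl2E g x y : (infl g).2 x y = g.2 (proj x) (proj y).
Proof. exact: bil_pullE. Qed.

Lemma infl_is_linear : linear infl.
Proof.
move=> a f g; apply: bilpairP => x y; rewrite bilpair_fstP bilpair_sndP.
split.
  rewrite (infl1E (a *: f + g)) (infl1E f) (infl1E g).
  by rewrite bilpair_fstP.
rewrite (infl2E (a *: f + g)) (infl2E f) (infl2E g).
by rewrite bilpair_sndP.
Qed.

Lemma infl_inj : injective infl.
Proof.
move=> g h e; apply/bilpairP => p q; rewrite -(proj_repr p) -(proj_repr q).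
by rewrite -!infl1E -!infl2E e.
Qed.

(** A cocycle of [L] that vanishes as soon as one of its arguments lies in [I]
    is inflated from a cocycle of [Q]. *)
Lemma cocycle_descent f : is_cocycle f ->
    (forall x y, x \in dideal_space I ->
       [/\ f.1 x y = 0, f.1 y x = 0, f.2 x y = 0 & f.2 y x = 0]) ->
  f \in (linfun infl @: Z2 Q)%VS.
Proof.
move=> Zf f0; pose g : bilpair Q := (bil_pull sec f.1, bil_pull sec f.2).
have gE x y :
  f.1 x y = g.1 (proj x) (proj y) /\ f.2 x y = g.2 (proj x) (proj y).
  rewrite !bil_pullE; split.
    have [+ _ _ _] := f0 _ (sec (proj y)) (sec_proj x).
    rewrite linearB add_lfunE opp_lfunE => /subr0_eq->.
    have [_ + _ _] := f0 _ x (sec_proj y).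
    by rewrite linearB => /subr0_eq.
  have [_ _ + _] := f0 _ (sec (proj y)) (sec_proj x).
  rewrite linearB add_lfunE opp_lfunE => /subr0_eq->.
  have [_ _ _ +] := f0 _ x (sec_proj y).
  by rewrite linearB => /subr0_eq.
have -> : f = linfun infl g.
  apply/bilpairP => x y; rewrite linfunE; last exact: infl_is_linear.
  by rewrite infl1E infl2E; apply: gE.
apply/memv_img/Z2P => p q r.
rewrite -(proj_repr p) -(proj_repr q) -(proj_repr r).
rewrite -!proj_dmull -!proj_dmulr.
have E1 x y := esym (gE x y).1; have E2 x y := esym (gE x y).2.
by rewrite !E1 !E2; apply: Zf.
Qed.

(** The transgression [Hom(I, F) -> H^2(L/I, F)] is injective for [I] inside
    [L^2]. Both spaces of coboundaries are images of linear forms under the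
    coboundary map, whose kernel on [L] consists of forms vanishing on [L^2],
    hence on [I]; the forms coming from [Q] have codimension [\dim I]. *)
Lemma dim_B2_quotient : (dideal_space I <= lcs L 2)%VS ->
  (\dim (B2 Q) + \dim (dideal_space I) <= \dim (B2 L))%N.
Proof.
move=> sI2.
pose pull e : 'Hom(L, F^o) := (e \o proj)%VF.
have pullL : linear pull.
  by move=> a e d; rewrite /pull comp_lfunDl comp_lfunZl.
pose W := limg (linfun pull); pose cobL := linfun (@cob F L).
have cobLE e : cobL e = cob e by rewrite linfunE //; apply: cob_is_linear.
have dimW : (\dim W <= \dim {:L} - \dim (dideal_space I))%N.
  rewrite -dim_quotv -(dim_form (quotv I)) -(limg_ker_dim (linfun pull)).
  exact: leq_addl.
have sub_ker : (lker cobL <= W)%VS.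
  apply/subvP => e; rewrite memv_ker cobLE => /eqP e0.
  have e2 : forall z, z \in lcs L 2 -> e z = 0.
    apply: lcs_ind => // [|a u v u0 v0|i j x y _ _ _ _ _].
    - by rewrite linear0.
    - by rewrite linearP /= u0 v0 scaler0 addr0.
    have c1 : cobl e = 0 by case: e0.
    have c2 : cobr e = 0 by case: e0.
    split; apply/eqP; rewrite -oppr_eq0.
      by rewrite -coblE c1 !zero_lfunE.
    by rewrite -cobrE c2 !zero_lfunE.
  have -> : e = linfun pull (e \o sec)%VF.
    (* [e] vanishes on [I], so it only depends on classes modulo [I]. *)
    rewrite linfunE //; apply/lfunP => x; rewrite !comp_lfunE.
    have /(subvP sI2)/e2 := sec_proj x.
    by rewrite linearB => /subr0_eq.
  by rewrite memv_img ?memvf.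
(* The inflation of the coboundary of [e] is the coboundary of [e \o proj]. *)
have subB : (linfun infl @: B2 Q <= cobL @: W)%VS.
  rewrite -limg_cob; apply/subvP => _ /memv_imgP[_ /memv_imgP[e _ ->] ->].
  have -> : linfun infl (linfun (@cob F Q) e) = cobL (linfun pull e).
    rewrite cobLE !linfunE //; [|exact: cob_is_linear|exact: infl_is_linear].
    apply: bilpairP => x y; rewrite infl1E infl2E !coblE !cobrE !comp_lfunE.
    by rewrite proj_dmull proj_dmulr.
  by rewrite !memv_img ?memvf.
have inflK : lker (linfun infl) == 0%VS.
  apply/lker0P => g h; rewrite !linfunE; try exact: infl_is_linear.
  exact: infl_inj.
have dimB : (\dim (B2 Q) <= \dim (cobL @: W))%N.
  rewrite -(limg_dim_eq (f := linfun infl) (U := B2 Q)) ?dimvS //.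
  by rewrite (eqP inflK) capv0.
have kW := limg_ker_dim cobL W; rewrite (capv_idPr sub_ker) in kW.
have kL := limg_ker_dim cobL fullv.
rewrite capfv limg_cob dim_form in kL.
have dimI : (\dim (dideal_space I) <= \dim {:L})%N by rewrite dimvS ?subvf.
lia.
Qed.

End Quotient.

(** * The bound *)

Section Bound.
Variables (F : fieldType) (L : diassType F).

(** With [Z = L^n] and [C] a complement of [Z_(n-1)], a cocycle whose two forms
    vanish on [Z * C] and on [C * Z] vanishes on [Z * L] and [L * Z], hence is
    inflated from the quotient. *)
Lemma dim_Z2_quotient n : (0 < n)%N ->
  (\dim (Z2 L) <= \dim (Z2 (dquot (lcs_ideal L n)))
     + 4 * \dim (lcs L n) * \dim {:quotv (ucs L n.-1)})%N.
Proof.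
move=> n_gt0; set I := lcs_ideal L n; set U := ucs L n.-1.
rewrite dim_quotv -dimv_compl.
set C := (U^C)%VS; set Z := lcs L n.
pose gram (f : bilpair L) :=
  ((gram_mx Z C f.1, gram_mx C Z f.1), (gram_mx Z C f.2, gram_mx C Z f.2)).
have gramL : linear gram.
  by move=> a f g; congr ((_, _), (_, _)); apply: gram_mx_is_linear.
have Zf0 f : is_cocycle f -> gram f = 0 -> forall x y, x \in Z ->
    [/\ f.1 x y = 0, f.1 y x = 0, f.2 x y = 0 & f.2 y x = 0].
  move=> Zf [g1 g2 g3 g4] x y xZ.
  (* Only the component of [y] in [C] matters, as [f] vanishes on [Z] and [U]. *)
  have : y \in (U + C)%VS by rewrite addv_complf memvf.
  move=> /memv_addP[u uU [c cC ->]].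
  have [|u1 u2 u3 u4] := cocycle_lcs_ucs Zf _ xZ uU; first by rewrite prednK.
  rewrite !linearD !add_lfunE /= u1 u2 u3 u4 !add0r.
  by split; [apply: gram_mx_eq0 g1 _ _|apply: gram_mx_eq0 g2 _ _
    |apply: gram_mx_eq0 g3 _ _|apply: gram_mx_eq0 g4 _ _].
apply: leq_trans (dim_le_ker_codomain (g := linfun gram)
  (K := (linfun (@infl F L I) @: Z2 _)%VS) _) _.
  move=> f /Z2P Zf; rewrite linfunE // => g0.
  by apply: cocycle_descent => // x y; apply: Zf0 Zf g0 x y.
apply: leq_add; first by rewrite -(limg_ker_dim (linfun (@infl F L I))) leq_addl.
by rewrite !dim_pair !dimvf !dim_matrix; lia.
Qed.

Lemma dim_Z2_le : (\dim (Z2 L) <= 2 * (\dim {:L} * \dim {:L}))%N.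
Proof.
apply: leq_trans (dimvS (subvf _)) _.
by rewrite dim_pair [\dim {:bilform L}]dim_hom dim_form; lia.
Qed.

End Bound.

Unset Implicit Arguments.

Theorem corollary4p4 (F : fieldType) (L : diassType F) (n : nat)
    (hL : nilpotent_of_class L n) :
  (\dim {:H2 L})%:Z <=
    (\dim {:H2 (dquot (lcs_ideal L n))})%:Z
      + 4 * (\dim (lcs L n))%:Z * (\dim {:quotv (ucs L n.-1)})%:Z
      - (\dim (lcs L n))%:Z.
Proof.
have [n_gt0 _ _] := hL; rewrite !dim_H2.
have [n1|n_gt1] := leqP n 1.
  (* With [d = \dim L], what remains is [2 * d ^ 2 <= 4 * d ^ 2 - d]. *)
  have -> : n = 1%N by apply/eqP; rewrite eqn_leq n1.
  rewrite lcs1 dim_quotv dimv0 subn0; have := dim_Z2_le L.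
  by move: (\dim (Z2 L)) (\dim (B2 L)) (\dim {:L}) => a b d; nia.
have := dim_Z2_quotient L n_gt0.
have := dim_B2_quotient (lcs_sub2 L n_gt1 : (dideal_space (lcs_ideal L n) <= _)%VS).
have := dimvS (B2_sub_Z2 L).
have := dimvS (B2_sub_Z2 (dquot (lcs_ideal L n))).
rewrite [dideal_space _]/=; lia.
Qed.
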